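(* Let $\mathcal H$ be a separable complex Hilbert space. If $C\in B(\mathcal H)$ is a trace-class operator and $A\in B(\mathcal H)$, then $W_C(A)$ is dense in $W_{\mathcal O(C)}(A)$. In particular, $\overline{W_C(A)}=\overline{W_{\mathcal O(C)}(A)}$.
   Context: For trace-class $C$, $\mathcal U(C)=\{UCU^*:U\text{ unitary}\}$ and $\mathcal O(C)$ is the closure of $\mathcal U(C)$ in the trace norm. The $C$-numerical range of $A$ is $W_C(A)=\{\operatorname{Tr}(XA): X\in\mathcal U(C)\}$ and the orbit-closed $C$-numerical range of $A$ is $W_{\mathcal O(C)}(A)=\{\operatorname{Tr}(XA): X\in\mathcal O(C)\}$. Bars denote closure in $\mathbb C$. *)

(* Defs.v *)
From HB Require Import structures.
From mathcomp Require Import all_boot all_order all_algebra.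
From mathcomp Require Import complex.
From mathcomp Require Import all_classical all_reals all_analysis.

Set Implicit Arguments.
Unset Strict Implicit.
Unset Printing Implicit Defensive.

Import Order.TTheory GRing.Theory Num.Theory.
Import numFieldNormedType.Exports.

Local Open Scope classical_set_scope.
Local Open Scope ring_scope.
Local Open Scope complex_scope.

(* A complex Hilbert space is a complete normed space [H] over [R[i]] together
   with a positive definite hermitian form [dot] such that
   [hilbert_norm dot] holds. By the conventions of [{dot H for _}], [dot] is
   linear in its first argument and conjugate linear in the second.

   The library puts a topology on [(R[i])^o] but not on [R[i]] itself, hence
   the type [(R[i])^o] for complex values of which limits or closures are
   taken. *)

Definition separable_space (T : topologicalType) : Prop :=
  exists2 D : set T, countable D & dense D.

Definition dense_in (T : topologicalType) (S S' : set T) : Prop :=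
  S `<=` S' /\ S' `<=` closure S.

Section Operators.
Variables (R : realType) (H : completeNormedModType R[i]).
Variable dot : {dot H for (@Num.conj R[i])}.

Definition hilbert_norm : Prop := forall x : H, `|x| ^+ 2 = dot x x.

Definition bounded_operator (T : H -> H) : Prop :=
  linear T /\ exists M : R, forall x, `|T x| <= M%:C * `|x|.

Definition is_adjoint (T S : H -> H) : Prop :=
  forall x y, dot (T x) y = dot x (S y).

(* For bounded [T] such an [S] exists (Riesz) and is unique, and
   likewise for the [P] in [abs_operator]. *)
Definition adjoint (T : H -> H) : H -> H :=
  xget (0 : H -> H) [set S | bounded_operator S /\ is_adjoint T S].

Definition unitary (U : H -> H) : Prop :=
  [/\ bounded_operator U, adjoint U \o U = id & U \o adjoint U = id].

(* The order of [R[i]] makes [0 <= z] mean that [z] is real and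
   nonnegative. *)
Definition positive_operator (T : H -> H) : Prop :=
  bounded_operator T /\ forall x, 0 <= dot (T x) x.

(* |T|, the positive square root of T^* T *)
Definition abs_operator (T : H -> H) : H -> H :=
  xget (0 : H -> H)
       [set P | positive_operator P /\ P \o P = adjoint T \o T].

(* An orthonormal basis is enumerated by [nat], where some of the [e k] may be
   [0]; the basis proper consists of the nonzero [e k]. This covers finite
   dimensional spaces, and the zero entries contribute nothing to traces. *)
Definition orthonormal_basis (e : nat -> H) : Prop :=
  [/\ forall i, e i = 0 \/ `|e i| = 1,
      forall i j, i != j -> dot (e i) (e j) = 0 &
      forall x, (forall i, dot x (e i) = 0) -> x = 0].

(* A fixed orthonormal basis, which exists when [H] is separable; the
   trace norm, and the trace of a trace-class operator, do not depend on it. *)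
Definition onb : nat -> H := xget (0 : nat -> H) orthonormal_basis.

(* ||T||_1 = Tr |T|, with value +oo when T is not trace class *)
Definition trace_norm (T : H -> H) : \bar R :=
  (\sum_(0 <= k <oo)
     (complex.Re (dot (abs_operator T (onb k)) (onb k)))%:E)%E.

Definition trace_class (T : H -> H) : Prop :=
  bounded_operator T /\ (trace_norm T < +oo)%E.

(* Meaningful for trace-class [T] only, as usual for [lim]. *)
Definition trace (T : H -> H) : (R[i])^o :=
  lim (series (fun k => dot (T (onb k)) (onb k) : (R[i])^o) @ \oo).

Definition unitary_orbit (C : H -> H) : set (H -> H) :=
  [set U \o C \o adjoint U | U in unitary].

(* Closure of [unitary_orbit C] in the trace-class operators *)
Definition closed_orbit (C : H -> H) : set (H -> H) :=
  [set X | trace_class X /\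
    forall eps : R, 0 < eps ->
      exists2 Y, unitary_orbit C Y & (trace_norm (X - Y)%R < eps%:E)%E].

Definition numerical_range (C A : H -> H) : set (R[i])^o :=
  [set trace (X \o A) | X in unitary_orbit C].

Definition closed_orbit_numerical_range (C A : H -> H) : set (R[i])^o :=
  [set trace (X \o A) | X in closed_orbit C].

End Operators.

(* Main.v *)
Require Import Defs.
From HB Require Import structures.
From mathcomp Require Import all_boot all_order all_algebra.
From mathcomp Require Import complex ring lra.
From mathcomp Require Import all_classical all_reals all_analysis.

Set Implicit Arguments.
Unset Strict Implicit.
Unset Printing Implicit Defensive.

Import Order.TTheory GRing.Theory Num.Theory.
Import numFieldNormedType.Exports.

Local Open Scope classical_set_scope.
Local Open Scope ring_scope.
Local Open Scope complex_scope.

(** The inclusion of the numerical range in the orbit-closed one is clear once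
   the unitary orbit of a trace-class [C] is known to consist of trace-class
   operators. Conversely, let [X] lie in the closed orbit and let [Y] in the
   unitary orbit satisfy [||X - Y||_1 < eps]; then
     [|Tr (X A) - Tr (Y A)| = |Tr ((X - Y) A)| <= ||A|| ||X - Y||_1],
   so that [Tr (Y A)] is as close to [Tr (X A)] as desired. The equality of
   closures follows formally.

   All the analysis is therefore in one inequality, [trace_norm_bound]: for
   bounded [D], [T], [B] and the fixed orthonormal basis [e],
     [sum_k |<D T B e_k, e_k>| <= ||D|| ||B|| ||T||_1].
   With [D = 1] it makes the trace series of [T B] absolutely convergent and
   bounds its sum. Applied to [V^* D], where [D T B = V |D T B|] is a polar
   decomposition, it bounds [||D T B||_1], because [|D T B| = V^* D T B]; this
   is the ideal property [trace_class_ideal], of which the conjugations [U C U^*]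
   are instances.

   To prove the inequality, write [T = V |T|] with [V] a contraction
   ([polar_decomposition]) and [|T| = S S] with [S] positive
   ([positive_sqrt_exists]). Then
     [<D T B e_k, e_k> = <S B e_k, S V^* D^* e_k>],
   and after Cauchy-Schwarz only the Hilbert-Schmidt sums of [S B] and of
   [S V^* D^*] are left. A Hilbert-Schmidt sum is unchanged under adjoints, by
   Parseval and an exchange of summations ([hs_norm_sq_adjoint]), so these are
   the sums of [B^* S] and [D V S], hence at most [||B||^2] and [||D||^2] times
   [sum_k |S e_k|^2 = sum_k <|T| e_k, e_k> = ||T||_1].

   Three existence results support this: an orthonormal basis comes from
   Gram-Schmidt applied to a dense sequence, adjoints come from Riesz-Fischer in
   that basis, and square roots are limits of an iteration of quadratic maps. *)

(** * Norms with real values *)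

Section RealNorm.
Variable R : realType.

(** Norms take values in [R[i]], whose order is only partial; the real part
   keeps all the information and lives in a complete totally ordered field. *)
Definition nrm (V : normedZmodType R[i]) (x : V) : R := complex.Re `|x|.

Lemma nrmE (V : normedZmodType R[i]) (x : V) : `|x| = (nrm x)%:C.
Proof. by rewrite /nrm RRe_real// ger0_real. Qed.

Lemma nrm_ge0 (V : normedZmodType R[i]) (x : V) : 0 <= nrm x.
Proof. by rewrite -ler0c -nrmE. Qed.

Lemma nrm0 (V : normedZmodType R[i]) : nrm (0 : V) = 0.
Proof. by rewrite /nrm normr0. Qed.

Lemma nrm_eq0 (V : normedZmodType R[i]) (x : V) : nrm x = 0 -> x = 0.
Proof. by move=> h; apply/normr0_eq0; rewrite nrmE h. Qed.

Lemma nrmN (V : normedZmodType R[i]) (x : V) : nrm (- x) = nrm x.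
Proof. by rewrite /nrm normrN. Qed.

Lemma nrmB (V : normedZmodType R[i]) (x y : V) : nrm (x - y) = nrm (y - x).
Proof. by rewrite /nrm distrC. Qed.

Lemma nrmD (V : normedZmodType R[i]) (x y : V) : nrm (x + y) <= nrm x + nrm y.
Proof. by rewrite -lecR rmorphD /= -!nrmE ler_normD. Qed.

Lemma nrm_distD (V : normedZmodType R[i]) (y x z : V) :
  nrm (x - z) <= nrm (x - y) + nrm (y - z).
Proof. by rewrite -lecR rmorphD /= -!nrmE ler_distD. Qed.

Lemma nrm_sum (V : normedZmodType R[i]) (m n : nat) (F : nat -> V) :
  nrm (\sum_(m <= k < n) F k) <= \sum_(m <= k < n) nrm (F k).
Proof.
rewrite -lecR rmorph_sum /= -nrmE (le_trans (ler_norm_sum _ _ _))//.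
by apply: ler_sum => k _; rewrite nrmE.
Qed.

Lemma nrmM (x y : R[i]) : nrm (x * y) = nrm x * nrm y.
Proof. by apply: complexI; rewrite -nrmE normrM !nrmE rmorphM. Qed.

Lemma nrm_real (a : R) : nrm (a%:C) = `|a|.
Proof. by rewrite /nrm normc_def /= expr0n /= addr0 sqrtr_sqr. Qed.

Lemma nrm_conj (x : R[i]) : nrm x^* = nrm x.
Proof. by rewrite /nrm normcJ. Qed.

Lemma nrmZ (V : normedModType R[i]) (a : R[i]) (x : V) :
  nrm (a *: x) = nrm a * nrm x.
Proof. by apply: complexI; rewrite -nrmE normrZ !nrmE rmorphM. Qed.

Lemma normRe (z : R[i]) : `|complex.Re z| <= nrm z.
Proof. by rewrite -lecR -nrmE normc_ge_Re. Qed.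

Lemma normIm (z : R[i]) : `|complex.Im z| <= nrm z.
Proof.
rewrite /nrm normc_def /= -[X in X <= _]sqrtr_sqr ler_sqrt.
  by rewrite lerDr sqr_ge0.
by rewrite addr_ge0 ?sqr_ge0.
Qed.

Lemma nrm_leReIm (z : R[i]) : nrm z <= `|complex.Re z| + `|complex.Im z|.
Proof.
rewrite {1}(complexE z); apply: le_trans (nrmD _ _) _.
have nrmi : nrm ('i%C : R[i]) = 1.
  by rewrite /nrm normc_def /= expr0n expr1n add0r sqrtr1.
by rewrite nrmM !nrm_real nrmi mul1r.
Qed.

Lemma cvg_nrm (V : normedModType R[i]) (u : nat -> V) (l : V) :
  u @ \oo --> l <-> (fun n => nrm (u n - l)) @ \oo --> (0 : R).
Proof.
split.
  move/cvgrPdist_lt => h; apply/cvgrPdist_lt => e e0.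
  have e0' : 0 < e%:C by rewrite ltcR.
  apply: filterS (h _ e0') => n /=.
  by rewrite nrmE ltcR sub0r normrN ger0_norm ?nrm_ge0// nrmB.
move/cvgrPdist_lt => h; apply/cvgrPdist_lt => e e0.
have eE : e = (complex.Re e)%:C by rewrite RRe_real// gtr0_real.
rewrite eE; apply: filterS (h (complex.Re e) _) => [n /=|].
  by rewrite nrmE ltcR sub0r normrN ger0_norm ?nrm_ge0// nrmB.
by rewrite -ltcR -eE.
Qed.

Lemma cvg_nrm_le (V : normedModType R[i]) (u : nat -> V) (l : V) (a : nat -> R) :
  (\forall n \near \oo, nrm (u n - l) <= a n) -> a @ \oo --> (0 : R) ->
  u @ \oo --> l.
Proof.
move=> h a0; apply/cvg_nrm; apply: (squeeze_cvgr _ (cvg_cst 0) a0).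
by apply: filterS h => n ->; rewrite nrm_ge0.
Qed.

Lemma nrm_lim_le (V : normedModType R[i]) (u : nat -> V) (l : V) (K : R) :
  u @ \oo --> l -> (\forall n \near \oo, nrm (u n) <= K) -> nrm l <= K.
Proof.
move=> /cvg_nrm ul uK; apply/ler_addgt0Pr => e e0.
near \oo => n.
have -> : l = - (u n - l) + u n by rewrite opprB subrK.
apply: le_trans (nrmD _ _) _; rewrite nrmN addrC lerD//; first by near: n.
apply/ltW; near: n; move/cvgrPdist_lt : ul => /(_ _ e0).
by apply: filterS => n; rewrite sub0r normrN ger0_norm ?nrm_ge0.
Unshelve. all: by end_near. Qed.

(** The squared distances of orthogonal partial sums, and those of the square
   root iteration, are controlled by increments of a real sequence. *)
Lemma complete_sq (V : completeNormedModType R[i]) (u : nat -> V) (a : nat -> R) :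
  (forall m n, (m <= n)%N -> nrm (u n - u m) ^+ 2 <= a n - a m) ->
  cvgn a -> cvgn u.
Proof.
move=> h /cauchy_cvgP/cauchy_ballP ca.
apply/cauchy_cvgP; apply/cauchy_ballP => e e0.
have eE : e = (complex.Re e)%:C by rewrite RRe_real// gtr0_real.
have e0' : 0 < complex.Re e by rewrite -ltcR -eE.
have e2 : 0 < complex.Re e ^+ 2 by rewrite exprn_gt0.
move: (ca _ e2); rewrite !near_simpl.
apply: filterS => -[m n] /=; rewrite -!ball_normE /=.
wlog mn : m n / (m <= n)%N => [W|].
  have [mn|/ltnW mn] := leqP m n; first exact: W.
  by move=> amn; rewrite distrC; apply: W => //; rewrite distrC.
rewrite eE nrmE ltcR distrC => h1.
rewrite -ltr_sqr ?nnegrE ?nrm_ge0 ?ltW// nrmB; apply: le_lt_trans h1.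
by apply: le_trans (h _ _ mn) _; exact: ler_norm.
Qed.

(** Completeness of the complex numbers is obtained from that of [R] by summing
   real and imaginary parts separately. *)
Lemma abs_series_cvg (z : nat -> (R[i])^o) (K : R) :
  (forall n, \sum_(0 <= k < n) nrm (z k) <= K) ->
  cvgn (series z) /\ nrm (limn (series z)) <= K.
Proof.
move=> zK.
have ca : cvgn (series (fun k => nrm (z k))).
  apply: nondecreasing_is_cvgn.
    by apply: nondecreasing_series => k _ _; exact: nrm_ge0.
  by exists K => _ [n _ <-]; exact: zK.
have cR : cvgn (series (fun k => complex.Re (z k))).
  apply: normed_cvg; apply: series_le_cvg ca => k //=; last exact: normRe.
  exact: nrm_ge0.
have cI : cvgn (series (fun k => complex.Im (z k))).
  apply: normed_cvg; apply: series_le_cvg ca => k //=; last exact: normIm.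
  exact: nrm_ge0.
have cz : series z @ \oo --> (limn (series (fun k => complex.Re (z k))) +i*
            limn (series (fun k => complex.Im (z k))) : (R[i])^o).
  move: cR cI; set a := limn _; set b := limn (series _) => cR cI.
  apply: (@cvg_nrm_le _ _ _ (fun n => `|series (fun k => complex.Re (z k)) n - a|
     + `|series (fun k => complex.Im (z k)) n - b|)).
    apply: nearW => n; apply: le_trans (nrm_leReIm _) _.
    have E : series z n = series (fun k => complex.Re (z k)) n +i*
                   series (fun k => complex.Im (z k)) n.
      rewrite /series /=; elim: n => [|n IH]; first by rewrite !big_geq.
      by rewrite !big_nat_recr//= IH; case: (z n).
    by rewrite E.
  rewrite -[X in _ --> X](addr0 0).
  have dist0 (v : nat -> R) : cvgn v -> `|v n - limn v| @[n --> \oo] --> (0 : R).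
    move=> cv; rewrite -(normr0 R) -(subrr (limn v)); apply: cvg_norm.
    by apply: cvgB; [exact: cv | exact: cvg_cst].
  by apply: cvgD; apply: dist0.
split; first by apply: (cvgP _ cz).
rewrite (cvg_lim _ cz)//; apply: (nrm_lim_le cz); apply: nearW => n.
by apply: le_trans (zK n); exact: nrm_sum.
Qed.
End RealNorm.

(** * Linear functions given by a property *)

Section LinearFunctions.
Variables (K : nzRingType) (U V : lmodType K) (T : U -> V).
Hypothesis linT : linear T.

(** Operators are bare functions with a linearity hypothesis; packing them makes
   the theory of morphisms available. *)
Lemma linear_fP : exists L : {linear U -> V}, T = L.
Proof.
pose L := GRing.isLinear.Build _ _ _ _ T linT.
pose F : {linear U -> V} := HB.pack T L.
by exists F.
Qed.

Lemma linear_f0 : T 0 = 0.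
Proof. by have [L ->] := linear_fP; exact: raddf0. Qed.
Lemma linear_fD x y : T (x + y) = T x + T y.
Proof. by have [L ->] := linear_fP; exact: raddfD. Qed.
Lemma linear_fB x y : T (x - y) = T x - T y.
Proof. by have [L ->] := linear_fP; exact: raddfB. Qed.
Lemma linear_fZ a x : T (a *: x) = a *: T x.
Proof. by have [L ->] := linear_fP; exact: linearZ. Qed.
Lemma linear_f_sum m n (F : nat -> U) :
  T (\sum_(m <= k < n) F k) = \sum_(m <= k < n) T (F k).
Proof. by have [L ->] := linear_fP; exact: raddf_sum. Qed.
End LinearFunctions.

(** * Geometry of the inner product *)

Section Hilbert.
Variables (R : realType) (H : completeNormedModType R[i]).
Variable dot : {dot H for (@Num.conj R[i])}.
Hypothesis Hnorm : hilbert_norm dot.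

Lemma dotC x y : dot x y = (dot y x)^*.
Proof. by rewrite hermC /= mul1r. Qed.

Lemma dot_self x : dot x x = (nrm x ^+ 2)%:C.
Proof. by rewrite -Hnorm nrmE rmorphXn. Qed.

Lemma nrm_sqE x : nrm x ^+ 2 = complex.Re (dot x x).
Proof. by rewrite dot_self. Qed.

Lemma dot0l x : dot 0 x = 0. Proof. exact: linear0l. Qed.
Lemma dot0r x : dot x 0 = 0. Proof. exact: linear0r. Qed.
Lemma dotDl x y z : dot (x + y) z = dot x z + dot y z.
Proof. exact: linearDl. Qed.
Lemma dotDr x y z : dot z (x + y) = dot z x + dot z y.
Proof. exact: linearDr. Qed.
Lemma dotBl x y z : dot (x - y) z = dot x z - dot y z.
Proof. exact: linearBl. Qed.
Lemma dotBr x y z : dot z (x - y) = dot z x - dot z y.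
Proof. exact: linearBr. Qed.
Lemma dotZl a x z : dot (a *: x) z = a * dot x z.
Proof. exact: linearZl_LR. Qed.
Lemma dotZr a x z : dot z (a *: x) = a^* * dot z x.
Proof. exact: linearZr_LR. Qed.
Lemma dot_suml m n (F : nat -> H) z :
  dot (\sum_(m <= k < n) F k) z = \sum_(m <= k < n) dot (F k) z.
Proof. exact: linear_sumlz. Qed.
Lemma dot_sumr m n (F : nat -> H) z :
  dot z (\sum_(m <= k < n) F k) = \sum_(m <= k < n) dot z (F k).
Proof. exact: linear_sumr. Qed.

Lemma mul_conj (z : R[i]) : z * z^* = (nrm z ^+ 2)%:C.
Proof. by rewrite -sqr_normc nrmE rmorphXn. Qed.

Lemma Re_conj (z : R[i]) : complex.Re z^* = complex.Re z.
Proof. by case: z. Qed.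

Lemma nrmD_sq x y : nrm (x + y) ^+ 2 =
  nrm x ^+ 2 + nrm y ^+ 2 + 2 * complex.Re (dot x y).
Proof.
rewrite !nrm_sqE dotDl !dotDr (dotC y x) !raddfD /= Re_conj; ring.
Qed.

Lemma nrmB_sq x y : nrm (x - y) ^+ 2 =
  nrm x ^+ 2 + nrm y ^+ 2 - 2 * complex.Re (dot x y).
Proof. by rewrite nrmD_sq nrmN -scaleN1r dotZr rmorphN1 mulN1r raddfN /= mulrN. Qed.

(** Expand the squared norm of [|y|^2 x - <x, y> y], a multiple of the component
   of [x] orthogonal to [y]. *)
Lemma cauchy_schwarz x y : nrm (dot x y) <= nrm x * nrm y.
Proof.
have [y0|y0] := eqVneq (nrm y) 0.
  by rewrite (nrm_eq0 y0) dot0r !nrm0 mulr0.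
have yp : 0 < nrm y by rewrite lt_def y0 nrm_ge0.
have := sqr_ge0 (nrm ((nrm y ^+ 2)%:C *: x - dot x y *: y)).
rewrite nrmB_sq dotZl dotZr [_^* * _]mulrC mul_conj -rmorphM /= !nrmZ nrm_real.
rewrite ger0_norm ?sqr_ge0// => h.
rewrite -ler_sqr ?nnegrE ?mulr_ge0 ?nrm_ge0//.
have y2 : 0 < nrm y ^+ 2 by rewrite exprn_gt0.
rewrite -(ler_pM2l y2); nra.
Qed.

Lemma Re_dot_le x y : complex.Re (dot x y) <= nrm x * nrm y.
Proof.
exact: le_trans (ler_norm _) (le_trans (normRe _) (cauchy_schwarz x y)).
Qed.

Lemma dot_eq0 (y : H) : (forall x, dot x y = 0) -> y = 0.
Proof.
move=> h; apply: nrm_eq0; apply/eqP; rewrite -sqrf_eq0; apply/eqP.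
by rewrite nrm_sqE h.
Qed.

Lemma dot_inj (y z : H) : (forall x, dot x y = dot x z) -> y = z.
Proof.
by move=> h; apply/eqP; rewrite -subr_eq0; apply/eqP/dot_eq0 => x; rewrite dotBr h subrr.
Qed.

Lemma cvg_dotl (u : nat -> H) l y :
  u @ \oo --> l -> (fun n => dot (u n) y : (R[i])^o) @ \oo --> (dot l y : (R[i])^o).
Proof.
move=> /cvg_nrm ul.
apply: (@cvg_nrm_le _ _ _ _ (fun n => nrm (u n - l) * nrm y)).
  by apply: nearW => n; rewrite -dotBl cauchy_schwarz.
by rewrite -(mul0r (nrm y)); apply: cvgM => //; exact: cvg_cst.
Qed.

Lemma cvg_dotr (u : nat -> H) l y :
  u @ \oo --> l -> (fun n => dot y (u n) : (R[i])^o) @ \oo --> (dot y l : (R[i])^o).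
Proof.
move=> /cvg_nrm ul.
apply: (@cvg_nrm_le _ _ _ _ (fun n => nrm y * nrm (u n - l))).
  by apply: nearW => n; rewrite -dotBr cauchy_schwarz.
by rewrite -(mulr0 (nrm y)); apply: cvgM => //; exact: cvg_cst.
Qed.

(** How inner products with the sum of a series are computed: they are constant
   from some rank on, so their limit is that constant. *)
Lemma dotl_lim (u : nat -> H) l y c :
  u @ \oo --> l -> (\forall n \near \oo, dot (u n) y = c) -> dot l y = c.
Proof.
move=> ul uc.
have h1 := @cvg_dotl _ _ y ul.
have h2 : (fun n => dot (u n) y : (R[i])^o) @ \oo --> (c : (R[i])^o).
  by apply: cvg_near_cst; apply: filterS uc => n ->.
exact: (@cvg_unique _ _ _ _ _ _ h1 h2).
Qed.

Lemma cvg_lin_bound (T : H -> H) (M : R) (u : nat -> H) l :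
  linear T -> (forall x, nrm (T x) <= M * nrm x) -> u @ \oo --> l ->
  (T \o u) @ \oo --> T l.
Proof.
move=> linT TM /cvg_nrm ul.
apply: (@cvg_nrm_le _ _ _ _ (fun n => M * nrm (u n - l))).
  by apply: nearW => n /=; rewrite -(linear_fB linT) TM.
by rewrite -(mulr0 M); apply: cvgM => //; exact: cvg_cst.
Qed.

End Hilbert.

(** * Orthonormal systems and Fourier series *)

Section Orthonormal.
Variables (R : realType) (H : completeNormedModType R[i]).
Variable dot : {dot H for (@Num.conj R[i])}.
Hypothesis Hnorm : hilbert_norm dot.

Lemma nonneg_series_cvg (a : nat -> R) (K : R) : (forall k, 0 <= a k) ->
  (forall n, \sum_(0 <= k < n) a k <= K) -> cvgn (series a).
Proof.
move=> a0 aK; apply: nondecreasing_is_cvgn.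
  by apply: nondecreasing_series => k _ _.
by exists K => _ [n _ <-]; exact: aK.
Qed.

Lemma pythagoras (v : nat -> H) m n : (forall i j, i != j -> dot (v i) (v j) = 0) ->
  nrm (\sum_(m <= k < n) v k) ^+ 2 = \sum_(m <= k < n) nrm (v k) ^+ 2.
Proof.
move=> ov; elim: n => [|n IH]; first by rewrite !big_geq// nrm0 expr0n.
have [mn|nm] := leqP m n; last by rewrite !big_geq// nrm0 expr0n.
rewrite !big_nat_recr//= (nrmD_sq Hnorm) IH dot_suml [X in complex.Re X]big_nat_cond.
rewrite [X in complex.Re X]big1 ?mulr0 ?addr0//.
by move=> k /andP[/andP[_ kn] _]; rewrite ov// ltn_eqF.
Qed.

Lemma orthogonal_series_cvg (v : nat -> H) (K : R) :
  (forall i j, i != j -> dot (v i) (v j) = 0) ->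
  (forall n, \sum_(0 <= k < n) nrm (v k) ^+ 2 <= K) ->
  cvgn (series v) /\ nrm (limn (series v)) ^+ 2 <= K.
Proof.
move=> ov vK.
have cv : cvgn (series v).
  apply: (@complete_sq _ _ _ (series (fun k => nrm (v k) ^+ 2))).
    by move=> m n mn; rewrite !sub_series_geq// pythagoras.
  by apply: (nonneg_series_cvg (K := K)) => // k; rewrite sqr_ge0.
split=> //.
have K0 : 0 <= K by apply: le_trans (vK 0%N); rewrite big_geq.
rewrite -(sqr_sqrtr K0) ler_sqr ?nnegrE ?nrm_ge0 ?sqrtr_ge0//.
apply: (nrm_lim_le cv); apply: nearW => n.
rewrite -ler_sqr ?nnegrE ?nrm_ge0 ?sqrtr_ge0// sqr_sqrtr//.
by rewrite /series /= pythagoras.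
Qed.

(** As in [orthonormal_basis], zero vectors are allowed: Gram-Schmidt produces
   one for each vector that depends on the preceding ones, and no reindexing is
   then needed. *)
Definition orthonormal_system (e : nat -> H) : Prop :=
  (forall i, e i = 0 \/ `|e i| = 1) /\
  (forall i j, i != j -> dot (e i) (e j) = 0).

(** The double orthogonal complement of the [e k], which in a Hilbert space is
   their closed linear span. *)
Definition closed_span (e : nat -> H) : set H :=
  [set x | forall z, (forall k, dot z (e k) = 0) -> dot z x = 0].

Section System.
Variable e : nat -> H.
Hypothesis oe : orthonormal_system e.

Lemma nrm_system i : e i = 0 \/ nrm (e i) = 1.
Proof. by case: oe => /(_ i)[]; [left | right; rewrite /nrm b]. Qed.

Lemma nrm_system_le i : nrm (e i) <= 1.
Proof. by have [->|->] := nrm_system i; rewrite ?nrm0. Qed.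

(** [dot (e i) (e i)] is 1, unless [e i = 0], and then both sides are 0. *)
Lemma dot_system x i : dot x (e i) * dot (e i) (e i) = dot x (e i).
Proof.
have [->|e1] := nrm_system i; first by rewrite !dot0r mulr0.
by rewrite (dot_self Hnorm) e1 expr1n mulr1.
Qed.

Lemma orthogonal_scaled (c : nat -> R[i]) i j : i != j ->
  dot (c i *: e i) (c j *: e j) = 0.
Proof. by move=> ij; rewrite dotZl dotZr oe.2// !mulr0. Qed.

Lemma nrm_fourier x k : nrm (dot x (e k) *: e k) = nrm (dot x (e k)).
Proof.
by rewrite nrmZ; have [->|->] := nrm_system k; rewrite ?dot0r ?nrm0 ?mul0r ?mulr1.
Qed.

(** The difference of the two sides is the squared distance from [x] to its
   partial Fourier sum. *)
Lemma bessel x n : \sum_(0 <= k < n) nrm (dot x (e k)) ^+ 2 <= nrm x ^+ 2.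
Proof.
set s := \sum_(_ <= _ < _) _.
have := sqr_ge0 (nrm (x - \sum_(0 <= k < n) dot x (e k) *: e k)).
rewrite (nrmB_sq Hnorm) pythagoras; last exact: orthogonal_scaled.
under eq_bigr do rewrite nrm_fourier.
rewrite dot_sumr.
have -> : \sum_(0 <= k < n) dot x (dot x (e k) *: e k) = s%:C.
  rewrite /s rmorph_sum /=; apply: eq_bigr => k _.
  by rewrite dotZr mulrC mul_conj.
rewrite /= -/s; lra.
Qed.

(** The factor [dot (e j) (e j)] kills the coefficients of the zero entries,
   which contribute nothing to the sum. *)
Lemma riesz_fischer (c : nat -> R[i]) (K : R) :
  (forall n, \sum_(0 <= k < n) nrm (c k *: e k) ^+ 2 <= K) ->
  [/\ cvgn (series (fun k => c k *: e k)),
      nrm (limn (series (fun k => c k *: e k))) ^+ 2 <= K &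
      forall j, dot (limn (series (fun k => c k *: e k))) (e j) =
                c j * dot (e j) (e j)].
Proof.
move=> cK.
have [cv nK] := orthogonal_series_cvg (orthogonal_scaled c) cK.
split=> // j; apply: (dotl_lim Hnorm cv).
exists j.+1 => // n /= jn.
rewrite /series /= dot_suml (big_cat_nat (n := j))//=; last exact: ltnW.
rewrite [X in X + _]big_nat_cond [X in X + _]big1 ?add0r; last first.
  by move=> k /andP[/andP[_ kj] _]; rewrite dotZl oe.2 ?mulr0// ltn_eqF.
rewrite big_ltn// dotZl [X in _ + X]big_nat_cond [X in _ + X]big1 ?addr0//.
by move=> k /andP[/andP[jk _] _]; rewrite dotZl oe.2 ?mulr0// gtn_eqF.
Qed.

(** The series has some sum [y] by Bessel and Riesz-Fischer. Then [x - y] is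
   orthogonal to every [e k], hence to [x] and to [y], hence to itself. *)
Lemma fourier_cvg x : closed_span e x ->
  series (fun k => dot x (e k) *: e k) @ \oo --> x.
Proof.
move=> hx.
have [|cv _ dy] := @riesz_fischer (fun k => dot x (e k)) (nrm x ^+ 2).
  by move=> n; under eq_bigr do rewrite nrm_fourier; exact: bessel.
set y := limn _ in cv dy.
suff xy : x = y by rewrite [X in _ --> X]xy; exact: cv.
have ze k : dot (x - y) (e k) = 0 by rewrite dotBl dy dot_system subrr.
have zy : dot y (x - y) = 0.
  apply: (dotl_lim Hnorm cv); apply: nearW => n.
  rewrite /series /= dot_suml big1// => k _.
  by rewrite dotZl [dot (e k) _]dotC ze rmorph0 mulr0.
apply/eqP; rewrite -subr_eq0; apply/eqP/nrm_eq0/eqP; rewrite -sqrf_eq0; apply/eqP.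
by rewrite (nrm_sqE Hnorm) dotBr hx// dotC zy rmorph0 subrr.
Qed.

(** The partial sums are the squared norms of the partial Fourier sums. *)
Lemma parseval x : closed_span e x ->
  (\sum_(0 <= k <oo) (nrm (dot x (e k)) ^+ 2)%:E = (nrm x ^+ 2)%:E)%E.
Proof.
move=> /fourier_cvg hx; apply: cvg_lim => //.
have -> : (fun n => \sum_(0 <= k < n) (nrm (dot x (e k)) ^+ 2)%:E)%E =
   (fun n => (nrm (series (fun k => dot x (e k) *: e k) n) ^+ 2)%:E).
  apply/funext => n; rewrite sumEFin /series /= pythagoras; last exact: orthogonal_scaled.
  by congr EFin; apply: eq_bigr => k _; rewrite nrm_fourier.
apply: cvg_EFin; first exact: nearW.
rewrite /comp /= !expr2.
suff h : (fun n => nrm (series (fun k => dot x (e k) *: e k) n)) @ \oo --> nrm x.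
  by apply: cvgM.
apply/cvgrPdist_lt => eps eps0; move/cvg_nrm/cvgrPdist_lt : hx => /(_ _ eps0).
apply: filterS => n; rewrite sub0r normrN [X in X < _ -> _]ger0_norm ?nrm_ge0//.
set u := series _ n => h.
apply: le_lt_trans h; rewrite ler_norml; apply/andP; split.
  by have := nrm_distD x u 0; rewrite !subr0; lra.
by have := nrm_distD u x 0; rewrite !subr0 nrmB; lra.
Qed.

End System.
End Orthonormal.

(** * Gram-Schmidt and orthonormal bases *)

Section GramSchmidt.
Variables (R : realType) (H : completeNormedModType R[i]).
Variable dot : {dot H for (@Num.conj R[i])}.
Hypothesis Hnorm : hilbert_norm dot.

(** Since [0^-1 = 0], the zero vector is sent to itself. *)
Definition normalize (v : H) : H := ((nrm v)^-1)%:C *: v.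

Lemma normalizeK v : (nrm v)%:C *: normalize v = v.
Proof.
have [v0|v0] := eqVneq (nrm v) 0.
  by rewrite (nrm_eq0 v0) /normalize !scaler0.
by rewrite /normalize scalerA -rmorphM /= divff// scale1r.
Qed.

Lemma normalize_norm v : normalize v = 0 \/ `|normalize v| = 1.
Proof.
have [v0|v0] := eqVneq (nrm v) 0.
  by left; rewrite (nrm_eq0 v0) /normalize scaler0.
by right; rewrite nrmE nrmZ nrm_real ger0_norm ?invr_ge0 ?nrm_ge0// mulVf.
Qed.

(** Each vector depends on all the previous ones; carrying the list of these
   makes the recursion structural, and [gram_schmidtE] is the usual formula. *)
Fixpoint gram_schmidt_seq (d : nat -> H) (n : nat) : seq H :=
  if n is m.+1 then
    let s := gram_schmidt_seq d m in
    rcons s (normalize (d m - \sum_(g <- s) dot (d m) g *: g))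
  else [::].

Definition gram_schmidt (d : nat -> H) (n : nat) : H :=
  nth 0 (gram_schmidt_seq d n.+1) n.

Lemma size_gram_schmidt_seq d n : size (gram_schmidt_seq d n) = n.
Proof. by elim: n => //= n IH; rewrite size_rcons IH. Qed.

Lemma gram_schmidt_seqE d n : gram_schmidt_seq d n = mkseq (gram_schmidt d) n.
Proof.
elim: n => // n IH; rewrite mkseqS -IH /gram_schmidt /=.
by rewrite nth_rcons size_gram_schmidt_seq ltnn eqxx.
Qed.

Lemma gram_schmidtE d n : gram_schmidt d n =
  normalize (d n - \sum_(0 <= k < n) dot (d n) (gram_schmidt d k) *: gram_schmidt d k).
Proof.
rewrite {1}/gram_schmidt /= nth_rcons size_gram_schmidt_seq ltnn eqxx.
by rewrite gram_schmidt_seqE big_map /index_iota subn0.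
Qed.

Lemma gram_schmidt_orthonormal d : orthonormal_system dot (gram_schmidt d).
Proof.
set g := gram_schmidt d.
have g01 i : g i = 0 \/ `|g i| = 1 by rewrite /g gram_schmidtE; exact: normalize_norm.
split=> //.
suff lt_orth n i j : (j < n)%N -> (i < j)%N -> dot (g j) (g i) = 0.
  move=> i j; rewrite neq_lt => /orP[ij|ji]; last exact: (@lt_orth i.+1).
  by rewrite dotC (@lt_orth j.+1)// rmorph0.
elim: n i j => // n IH i j; rewrite ltnS leq_eqVlt => /orP[/eqP ->|]; last exact: IH.
move=> ii; rewrite {1}/g gram_schmidtE dotZl dotBl dot_suml -/g.
suff -> : \sum_(0 <= k < n) dot (dot (d n) (g k) *: g k) (g i) = dot (d n) (g i).
  by rewrite subrr mulr0.
rewrite (big_cat_nat (n := i))//=; last exact: ltnW.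
rewrite [X in X + _]big_nat_cond [X in X + _]big1 ?add0r; last first.
  move=> k /andP[/andP[_ ki] _]; rewrite dotZl.
  by rewrite [dot (g k) _]dotC (IH _ _ ii ki) rmorph0 mulr0.
rewrite big_ltn// dotZl [X in _ + X]big_nat_cond [X in _ + X]big1 ?addr0; last first.
  by move=> k /andP[/andP[ik kn] _]; rewrite dotZl (IH _ _ kn ik) mulr0.
have [gi0|gi1] := g01 i; first by rewrite gi0 !dot0r mulr0.
have : nrm (g i) = 1 by rewrite /nrm gi1.
by rewrite (dot_self Hnorm) => ->; rewrite expr1n mulr1.
Qed.

Lemma gram_schmidt_span d n :
  let p := \sum_(0 <= k < n) dot (d n) (gram_schmidt d k) *: gram_schmidt d k in
  d n = (nrm (d n - p))%:C *: gram_schmidt d n + p.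
Proof. by rewrite /= [gram_schmidt d n]gram_schmidtE normalizeK subrK. Qed.

Lemma gram_schmidt_perp d x :
  (forall n, dot x (gram_schmidt d n) = 0) -> forall n, dot x (d n) = 0.
Proof.
move=> xg n; rewrite [d n]gram_schmidt_span dotDr dotZr xg mulr0 add0r dot_sumr.
by rewrite big1// => k _; rewrite dotZr xg mulr0.
Qed.

(** The new vectors are combinations of the old ones, so they stay in any
   subspace containing these; the subspaces that occur are ranges. *)
Lemma gram_schmidt_range (T : H -> H) d : linear T ->
  (forall n, range T (d n)) -> forall n, range T (gram_schmidt d n).
Proof.
move=> linT dT n; elim/ltn_ind: n => n IH.
have sumT m (c : nat -> R[i]) : (m <= n)%N ->
    range T (\sum_(0 <= k < m) c k *: gram_schmidt d k).
  elim: m => [_|m IHm mn]; first by exists 0; rewrite ?big_geq ?(linear_f0 linT).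
  rewrite big_nat_recr//=; have [a _ <-] := IHm (ltnW mn).
  by have [b _ <-] := IH m mn; exists (c m *: b + a); rewrite ?linT// addrC.
have [a _ aE] := dT n.
have [b _ bE] := sumT n (fun k => dot (d n) (gram_schmidt d k)) (leqnn n).
rewrite gram_schmidtE -bE -aE -(linear_fB linT).
exists ((nrm (T (a - b)))^-1%:C *: (a - b)) => //.
by rewrite (linear_fZ linT).
Qed.

(** Gram-Schmidt is applied to an enumeration of a dense set: a vector orthogonal
   to the result is orthogonal to the dense set, hence to points arbitrarily
   close to itself, and must vanish. *)
Lemma orthonormal_basis_exists : separable_space H ->
  exists e : nat -> H, orthonormal_basis dot e.
Proof.
case=> D /countable_injP[f injf] denseD.
(* on the values taken by [f] on [D], an inverse of [f] *)
pose d n := xget (0 : H) [set x | D x /\ f x = n].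
have dD x : D x -> d (f x) = x.
  move=> Dx; have [Dd fd] : D (d (f x)) /\ f (d (f x)) = f x.
    by apply: (@xgetPex _ _ [set y | D y /\ f y = f x]); exists x.
  by apply: injf => //; rewrite inE.
exists (gram_schmidt d).
have [n01 orth] := gram_schmidt_orthonormal d; split=> // x xg.
have xD y : D y -> dot x y = 0.
  by move=> Dy; rewrite -(dD y Dy); exact: gram_schmidt_perp.
apply: nrm_eq0; apply/eqP; rewrite eq_le nrm_ge0 andbT.
apply/ler_addgt0Pr => eps eps0; rewrite add0r.
have epsC : 0 < eps%:C by rewrite ltcR.
have [|y [xy Dy]] := denseD (ball x eps%:C) _ (ball_open _ _).
  by exists x; exact: ballxx.
move: xy; rewrite -ball_normE /= nrmE ltcR => xy.
have : nrm x ^+ 2 <= nrm x * nrm (x - y).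
  rewrite (nrm_sqE Hnorm) -[dot x x]subr0 -(xD y Dy) -dotBr.
  exact: (Re_dot_le Hnorm).
have := nrm_ge0 x; nra.
Qed.

Lemma onbP : separable_space H -> orthonormal_basis dot (onb dot).
Proof. by move=> /orthonormal_basis_exists he; apply: xgetPex. Qed.

End GramSchmidt.

(** * Bounded, adjoint and positive operators *)

Section Operators.
Variables (R : realType) (H : completeNormedModType R[i]).
Variable dot : {dot H for (@Num.conj R[i])}.
Hypothesis Hnorm : hilbert_norm dot.

Definition op_bound (M : R) (T : H -> H) : Prop :=
  linear T /\ forall x, nrm (T x) <= M * nrm x.

Lemma sqr_le_mul (a b : R) : 0 <= a -> 0 <= b -> a ^+ 2 <= a * b -> a <= b.
Proof.
rewrite le_eqVlt => /orP[/eqP <- //|a0] _.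
by rewrite expr2 ler_pM2l.
Qed.

Lemma bounded_operatorP (T : H -> H) :
  bounded_operator T <-> exists2 M : R, 0 < M & op_bound M T.
Proof.
split=> [[linT [M TM]]|[M M0 [linT TM]]]; last first.
  by split=> //; exists M => x; rewrite !nrmE -rmorphM lecR.
exists (`|M| + 1); first by rewrite ltr_wpDl.
split=> // x; have := TM x; rewrite !nrmE -rmorphM lecR => /le_trans; apply.
by apply: ler_wpM2r; [exact: nrm_ge0 | rewrite ler_wpDr// ler_norm].
Qed.

Lemma op_bound_comp (M N : R) (S T : H -> H) : 0 <= M ->
  op_bound M S -> op_bound N T -> op_bound (M * N) (S \o T).
Proof.
move=> M0 [linS SM] [linT TN]; split=> [a x y|x] /=; first by rewrite linT linS.
by apply: le_trans (SM _) _; rewrite -mulrA ler_wpM2l.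
Qed.

Lemma is_adjoint_sym (T S : H -> H) : is_adjoint dot T S -> is_adjoint dot S T.
Proof. by move=> TS x y; rewrite dotC -TS [RHS]dotC. Qed.

Lemma is_adjoint_comp (S S' T T' : H -> H) :
  is_adjoint dot S S' -> is_adjoint dot T T' -> is_adjoint dot (S \o T) (T' \o S').
Proof. by move=> SS' TT' x y /=; rewrite SS' TT'. Qed.

(** [|S y|^2 = <T S y, y> <= M |S y| |y|]. *)
Lemma is_adjoint_op_bound (M : R) (T S : H -> H) :
  is_adjoint dot T S -> op_bound M T -> op_bound M S.
Proof.
move=> TS [_ TM]; split=> [a x y|y].
  by apply: (dot_inj Hnorm) => z; rewrite dotDr dotZr -!TS dotDr dotZr.
apply: sqr_le_mul; first exact: nrm_ge0.
  by apply: le_trans (TM y); exact: nrm_ge0.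
rewrite (nrm_sqE Hnorm) -TS mulrA [_ * M]mulrC; apply: le_trans (Re_dot_le Hnorm _ _) _.
by rewrite ler_wpM2r ?nrm_ge0.
Qed.

Lemma bounded_cvg (T : H -> H) (u : nat -> H) l :
  bounded_operator T -> u @ \oo --> l -> (T \o u) @ \oo --> T l.
Proof. by move=> /bounded_operatorP[M _ [linT TM]]; exact: cvg_lin_bound TM. Qed.

Lemma orthonormal_basis_system e : orthonormal_basis dot e -> orthonormal_system dot e.
Proof. by case. Qed.

Lemma orthonormal_basis_span e x : orthonormal_basis dot e -> closed_span dot e x.
Proof. by case=> _ _ tot z /tot ->; rewrite dot0l. Qed.

(** [T^* y] must have the coordinates [<y, T e_k>]. For a partial sum [z] of
   the corresponding series, [|z|^2 <= <y, T z> <= M |y| |z|], so that the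
   partial sums are bounded and Riesz-Fischer applies. *)
Lemma adjoint_exists (e : nat -> H) (T : H -> H) :
  orthonormal_basis dot e -> bounded_operator T ->
  exists S, bounded_operator S /\ is_adjoint dot T S.
Proof.
move=> be bT; have oe := orthonormal_basis_system be.
have [M M0 [linT TM]] := (bounded_operatorP T).1 bT.
pose c y k := dot y (T (e k)).
have cK y n : \sum_(0 <= k < n) nrm (c y k *: e k) ^+ 2 <= (M * nrm y) ^+ 2.
  set z := \sum_(0 <= k < n) c y k *: e k.
  have zE : nrm z ^+ 2 = \sum_(0 <= k < n) nrm (c y k *: e k) ^+ 2.
    by rewrite (pythagoras Hnorm)//; exact: orthogonal_scaled.
  have : nrm z ^+ 2 <= nrm y * (M * nrm z).
    apply: (@le_trans _ _ (complex.Re (dot y (T z)))); last first.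
      apply: le_trans (Re_dot_le Hnorm _ _) _.
      by rewrite ler_wpM2l ?nrm_ge0.
    rewrite (linear_f_sum linT) dot_sumr raddf_sum zE; apply: ler_sum => k _ /=.
    rewrite (linear_fZ linT) dotZr mulrC mul_conj /= nrmZ exprMn.
    rewrite -[leRHS]mulr1 ler_wpM2l ?sqr_ge0// expr_le1 ?nrm_ge0//.
    exact: (nrm_system_le oe).
  rewrite -zE => h; rewrite ler_sqr ?nnegrE ?mulr_ge0 ?nrm_ge0 ?(ltW M0)//.
  apply: sqr_le_mul; rewrite ?nrm_ge0 ?mulr_ge0 ?nrm_ge0 ?(ltW M0)//.
  by move: h; congr (_ <= _); ring.
pose S y := limn (series (fun k => c y k *: e k)).
have TS : is_adjoint dot T S.
  move=> x y; have [_ _ Se] := riesz_fischer Hnorm oe (cK y).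
  have xn := fourier_cvg Hnorm oe (orthonormal_basis_span x be).
  have l1 := @cvg_dotl _ _ _ Hnorm _ _ y (bounded_cvg bT xn).
  have l2 := @cvg_dotl _ _ _ Hnorm _ _ (S y) xn.
  suff E : (fun n => dot ((T \o series (fun k => dot x (e k) *: e k)) n) y) =
       (fun n => dot (series (fun k => dot x (e k) *: e k) n) (S y)).
    by rewrite E in l1; exact: (@cvg_unique _ _ _ _ _ _ l1 l2).
  apply/funext => n /=; rewrite /series /= (linear_f_sum linT) !dot_suml.
  apply: eq_bigr => k _; rewrite (linear_fZ linT) !dotZl; congr (_ * _).
  rewrite dotC [RHS]dotC; congr (_^*); rewrite Se.
  have [e0|e1] := nrm_system oe k.
    by rewrite e0 (linear_f0 linT) !dot0r mulr0.
  by rewrite (dot_self Hnorm) e1 expr1n mulr1.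
exists S; split=> //; apply/bounded_operatorP; exists M => //.
exact: is_adjoint_op_bound TS (conj linT TM).
Qed.

(** Polarization: the form [<P x, y> - <x, P y>] is sesquilinear and vanishes on
   the diagonal, [<P x, x>] being real; comparing its values at [(x, y)] and
   [('i x, y)] shows that it vanishes everywhere. *)
Lemma positive_self_adjoint (P : H -> H) :
  positive_operator dot P -> is_adjoint dot P P.
Proof.
move=> [[linP _] posP].
pose f x y := dot (P x) y - dot x (P y).
have fxx x : f x x = 0.
  rewrite /f [dot x _]dotC; have := ger0_Im (posP x).
  by case: (dot _ _) => a b /= ->; rewrite /= oppr0 subrr.
have fD x y : f x y + f y x = 0.
  have := fxx (x + y); rewrite /f (linear_fD linP) !dotDl !dotDr => h.
  have := fxx x; have := fxx y; rewrite /f => hy hx.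
  rewrite -[RHS]h -[LHS]addr0 -[LHS]addr0 -{1}hx -{1}hy; ring.
(* the imaginary unit *)
pose j : R[i] := 0 +i* 1.
have jC : Num.conj j = - j by apply/eqP; rewrite eq_complex /= oppr0 !eqxx.
have j0 : j != 0 by rewrite eq_complex /= oner_eq0 andbF.
have fj x y : f (j *: x) y + f y (j *: x) = j * (f x y - f y x).
  by rewrite /f (linear_fZ linP) !dotZl !dotZr jC; ring.
move=> x y; apply/eqP; rewrite -subr_eq0 -/(f x y).
have /eqP := fD (j *: x) y; rewrite fj mulf_eq0 (negbTE j0) /= subr_eq0 => /eqP h.
by have /eqP := fD x y; rewrite -h -mulr2n mulrn_eq0.
Qed.

(** Expand [0 <= <P v, v>] for [v = M x - P x]. *)
Lemma positive_nrm_sq (M : R) (P : H -> H) x : 0 < M ->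
  op_bound M P -> positive_operator dot P ->
  nrm (P x) ^+ 2 <= M * complex.Re (dot (P x) x).
Proof.
move=> M0 [linP PM] pP.
have sP := positive_self_adjoint pP.
have [_ posP] := pP.
have := posP (M%:C *: x - P x).
rewrite lecE => /andP[_] /=.
rewrite (linear_fB linP) (linear_fZ linP) dotBl !dotBr !dotZl !dotZr.
have -> : dot (P (P x)) x = dot (P x) (P x) by rewrite sP.
rewrite (dot_self Hnorm).
have PPx : complex.Re (dot (P (P x)) (P x)) <= M * nrm (P x) ^+ 2.
  apply: le_trans (Re_dot_le Hnorm _ _) _.
  by rewrite expr2 mulrA ler_wpM2r ?nrm_ge0.
move: PPx; case: (dot (P (P x)) (P x)) => w1 w2; case: (dot (P x) x) => q1 q2 /=.
move: (nrm (P x) ^+ 2) => n; rewrite !(mul0r, mulr0, oppr0, subr0, addr0, add0r) => h1 h2.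
have : 0 <= M * (M * q1 - n) by lra.
by rewrite pmulr_rge0// subr_ge0.
Qed.

End Operators.

(** * Square roots of positive operators *)

Section SquareRoot.
Variables (R : realType) (H : completeNormedModType R[i]).
Variable dot : {dot H for (@Num.conj R[i])}.
Hypothesis Hnorm : hilbert_norm dot.

Section Iteration.
Variable B : H -> H.
Hypothesis B1 : op_bound 1 B.
Hypothesis Bs : is_adjoint dot B B.

(** If [Y] is a fixed point of the iteration, then [2 Y = B + Y^2], that is,
   [(1 - Y)^2 = 1 - B]: a square root of [1 - B] is obtained as [1 - Y]. *)
Fixpoint sqrt_iter (n : nat) (x : H) : H :=
  if n is m.+1 then 2^-1 *: (B x + sqrt_iter m (sqrt_iter m x)) else 0.

(** The same iteration for the number 1. It increases and is bounded by 1, and it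
   dominates the operator iteration both in norm and in increments. *)
Fixpoint scalar_iter (n : nat) : R :=
  if n is m.+1 then 2^-1 * (1 + scalar_iter m ^+ 2) else 0.

Lemma scalar_iter01 n : 0 <= scalar_iter n <= 1.
Proof. elim: n => [|n /andP[a0 a1]] /=; nra. Qed.

Lemma scalar_iterS n : scalar_iter n <= scalar_iter n.+1.
Proof. rewrite /=; have := sqr_ge0 (1 - scalar_iter n); nra. Qed.

Lemma scalar_iter_cvg : cvgn scalar_iter.
Proof.
apply: nondecreasing_is_cvgn; first by apply/nondecreasing_seqP; exact: scalar_iterS.
by exists 1 => _ [n _ <-]; case/andP: (scalar_iter01 n).
Qed.

Lemma nrm_half (V : normedModType R[i]) (x : V) : nrm (2^-1 *: x) = 2^-1 * nrm x.
Proof.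
rewrite nrmZ; congr (_ * _).
have -> : (2^-1 : R[i]) = (2^-1 : R)%:C by rewrite fmorphV rmorph_nat.
by rewrite nrm_real ger0_norm ?invr_ge0.
Qed.

Lemma sqrt_iter_bound n : op_bound (scalar_iter n) (sqrt_iter n).
Proof.
elim: n => [|n [linY Yn]].
  by split=> [a x y|x] /=; rewrite ?scaler0 ?addr0// nrm0 mul0r.
split=> [a x y|x] /=.
  rewrite B1.1 !linY scalerA mulrC -scalerA -scalerDr; congr (_ *: _).
  by rewrite scalerDr addrACA.
rewrite nrm_half -mulrA ler_wpM2l ?invr_ge0//.
apply: le_trans (nrmD _ _) _; rewrite mulrDl lerD ?B1.2//.
apply: le_trans (Yn _) _; rewrite expr2 -mulrA ler_wpM2l//.
by case/andP: (scalar_iter01 n).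
Qed.

Lemma conj_half : Num.conj (2^-1 : R[i]) = 2^-1.
Proof. by rewrite fmorphV rmorph_nat. Qed.

Lemma sqrt_iter_self_adjoint n : is_adjoint dot (sqrt_iter n) (sqrt_iter n).
Proof.
elim: n => [|n IH] x y /=; first by rewrite dot0l dot0r.
by rewrite dotZl dotZr conj_half dotDl dotDr Bs !IH.
Qed.

(** With [Y'] following [Y], the next increment is half of
   [Y'^2 - Y^2 = Y' (Y' - Y) + (Y' - Y) Y], and the scalar iteration satisfies the
   same identity. *)
Lemma sqrt_iterS_dist n x : nrm (sqrt_iter n.+1 x - sqrt_iter n x) <=
  (scalar_iter n.+1 - scalar_iter n) * nrm x.
Proof.
elim: n x => [|n IH] x.
  rewrite !subr0 /= addr0 expr0n addr0 mulr1 nrm_half ler_wpM2l ?invr_ge0//.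
  by rewrite -[leRHS]mul1r B1.2.
have [linY Yn] := sqrt_iter_bound n.
have [linY' Yn'] := sqrt_iter_bound n.+1.
have YS m : sqrt_iter m.+1 x = 2^-1 *: (B x + sqrt_iter m (sqrt_iter m x)) by [].
have aS m : scalar_iter m.+1 = 2^-1 * (1 + scalar_iter m ^+ 2) by [].
have -> : sqrt_iter n.+2 x - sqrt_iter n.+1 x =
    2^-1 *: (sqrt_iter n.+1 (sqrt_iter n.+1 x - sqrt_iter n x) +
     (sqrt_iter n.+1 (sqrt_iter n x) - sqrt_iter n (sqrt_iter n x))).
  rewrite (linear_fB linY') addrA subrK (YS n.+1) [X in _ - X](YS n) -scalerBr.
  by rewrite opprD addrACA subrr add0r.
have -> : scalar_iter n.+2 - scalar_iter n.+1 = 2^-1 *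
    (scalar_iter n.+1 * (scalar_iter n.+1 - scalar_iter n) +
     (scalar_iter n.+1 - scalar_iter n) * scalar_iter n).
  by rewrite (aS n.+1) [X in _ - X = _](aS n); ring.
rewrite nrm_half -mulrA ler_wpM2l ?invr_ge0// mulrDl.
apply: le_trans (nrmD _ _) _; apply: lerD.
  apply: le_trans (Yn' _) _; rewrite -mulrA ler_wpM2l//.
  by case/andP: (scalar_iter01 n.+1).
apply: le_trans (IH _) _; rewrite -mulrA ler_wpM2l//.
by rewrite subr_ge0 scalar_iterS.
Qed.

Lemma sqrt_iter_dist m n x : (m <= n)%N ->
  nrm (sqrt_iter n x - sqrt_iter m x) <= (scalar_iter n - scalar_iter m) * nrm x.
Proof.
elim: n => [|n IH].
  by rewrite leqn0 => /eqP ->; rewrite !subrr nrm0 mul0r.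
rewrite leq_eqVlt => /orP[/eqP <-|]; first by rewrite !subrr nrm0 mul0r.
move/IH => h; apply: le_trans (nrm_distD (sqrt_iter n x) _ _) _.
apply: le_trans (lerD (sqrt_iterS_dist _ _) h) _.
by rewrite -mulrDl addrA subrK.
Qed.

Lemma sqrt_iter_cvg x : cvgn (fun n => sqrt_iter n x).
Proof.
apply: (@complete_sq _ _ _ (fun n => scalar_iter n * nrm x ^+ 2)).
  move=> m n mn; rewrite -mulrBl.
  have d0 : 0 <= scalar_iter n - scalar_iter m.
    by rewrite subr_ge0; exact: (nondecreasing_seqP _).1 scalar_iterS _ _ mn.
  have d1 : scalar_iter n - scalar_iter m <= 1.
    have := scalar_iter01 n; have := scalar_iter01 m; lra.
  have h := sqrt_iter_dist x mn.
  apply: le_trans (_ : ((scalar_iter n - scalar_iter m) * nrm x) ^+ 2 <= _).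
    by rewrite ler_sqr ?nnegrE ?mulr_ge0 ?nrm_ge0.
  rewrite exprMn ler_wpM2r ?sqr_ge0// expr2 -[leRHS]mulr1 ler_wpM2l//.
by apply: is_cvgM; [exact: scalar_iter_cvg | exact: is_cvg_cst].
Qed.

(** The increments at [x] are at most those of the scalar iteration times the
   norm of [x], so the iterates converge pointwise; the uniform bounds let the
   limit pass through the square. *)
Lemma half_square_fixpoint : exists Y : H -> H,
  [/\ op_bound 1 Y, is_adjoint dot Y Y & forall x, Y x = 2^-1 *: (B x + Y (Y x))].
Proof.
pose Y x := limn (fun n => sqrt_iter n x).
have cY x : (fun n => sqrt_iter n x) @ \oo --> Y x by exact: sqrt_iter_cvg.
have Yle n x : nrm (sqrt_iter n x) <= nrm x.
  apply: le_trans ((sqrt_iter_bound n).2 x) _.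
  by rewrite ler_piMl ?nrm_ge0//; case/andP: (scalar_iter01 n).
have linY : linear Y.
  move=> a x y; apply: cvg_lim => //.
  under eq_fun do rewrite (sqrt_iter_bound _).1.
  by apply: cvgD; [apply: cvgZr; exact: cY | exact: cY].
exists Y; split.
- split=> // x; rewrite mul1r; apply: (nrm_lim_le (cY x)); exact: nearW.
- move=> x y.
  have l1 := @cvg_dotl _ _ _ Hnorm _ _ y (cY x).
  have l2 := @cvg_dotr _ _ _ Hnorm _ _ x (cY y).
  have E : (fun n => dot (sqrt_iter n x) y) = (fun n => dot x (sqrt_iter n y)).
    by apply/funext => n; exact: sqrt_iter_self_adjoint.
  by rewrite E in l1; exact: (@cvg_unique _ _ _ _ _ _ l1 l2).
- move=> x.
  have l1 : (fun n => sqrt_iter n.+1 x) @ \oo --> Y x.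
    by rewrite (@cvg_shiftS _ (fun n => sqrt_iter n x)); exact: cY.
  have l2 : (fun n => sqrt_iter n (sqrt_iter n x)) @ \oo --> Y (Y x).
    have h1 := (cvg_nrm _ _).1 (cY x).
    have h2 := (cvg_nrm _ _).1 (cY (Y x)).
    have h := cvgD h1 h2; rewrite addr0 in h.
    apply: (@cvg_nrm_le _ _ _ _ (fun n => nrm (sqrt_iter n x - Y x) +
      nrm (sqrt_iter n (Y x) - Y (Y x)))); last exact: h.
    apply: nearW => n.
    apply: le_trans (nrm_distD (sqrt_iter n (Y x)) _ _) _.
    by rewrite /= lerD2r -(linear_fB (sqrt_iter_bound n).1) Yle.
  have l3 : (fun n => sqrt_iter n.+1 x) @ \oo --> 2^-1 *: (B x + Y (Y x)).
    by apply: cvgZr; apply: cvgD => //; exact: cvg_cst.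
  exact: (@cvg_unique _ _ _ _ _ _ l1 l3).
Qed.
End Iteration.

(** If [M] bounds [P], then [B = 1 - P / M] is a contraction, because
   [|P x|^2 <= M <P x, x>] by [positive_nrm_sq]. The fixed point [Y] of the
   iteration gives [(1 - Y)^2 = P / M], and [1 - Y] is positive since [Y] is a
   contraction. *)
Lemma positive_sqrt_exists (P : H -> H) : positive_operator dot P ->
  exists S, positive_operator dot S /\ S \o S = P.
Proof.
move=> pP; have [/bounded_operatorP[M M0 bP] posP] := pP.
have sP := positive_self_adjoint pP.
pose B x := x - (M^-1)%:C *: P x.
have rC (r : R) : Num.conj r%:C = r%:C by exact: conjc_real.
have linB : linear B.
  move=> a x y; rewrite /B bP.1 scalerDr scalerA mulrC -scalerA scalerBr opprD.
  exact: addrACA.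
have B1 : op_bound 1 B.
  split=> // x; rewrite mul1r -ler_sqr ?nnegrE ?nrm_ge0// /B (nrmB_sq Hnorm).
  rewrite nrmZ nrm_real ger0_norm ?invr_ge0 ?(ltW M0)// exprMn dotZr rC.
  have h := positive_nrm_sq Hnorm x M0 bP pP.
  move: h; rewrite sP; case: (dot x (P x)) => q q' /= h.
  rewrite mul0r subr0.
  have h1 : M^-1 ^+ 2 * nrm (P x) ^+ 2 <= M^-1 * q.
    apply: le_trans (_ : M^-1 ^+ 2 * (M * q) <= _).
      by rewrite ler_wpM2l ?sqr_ge0.
    by rewrite expr2 mulrA -[_ * _ * M]mulrA mulVf ?mulr1 ?gt_eqF.
  have h2 : 0 <= M^-1 ^+ 2 * nrm (P x) ^+ 2 by rewrite mulr_ge0 ?sqr_ge0.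
  lra.
have Bs : is_adjoint dot B B.
  by move=> x y; rewrite /B dotBl dotBr dotZl dotZr rC sP.
have [Y [Y1 Ys YE]] := half_square_fixpoint B1 Bs.
(* [1 - Y] is a square root of [P / M], to be rescaled *)
pose c : R := Num.sqrt M.
have cM : (c%:C) * (c%:C) = M%:C by rewrite -rmorphM -expr2 sqr_sqrtr ?(ltW M0).
pose S x := c%:C *: (x - Y x).
have SS x : S (S x) = P x.
  rewrite /S (linear_fZ Y1.1) -scalerBr scalerA cM (linear_fB Y1.1).
  have : Y x + Y x = B x + Y (Y x).
    have half : (2 : R[i]) * 2^-1 = 1 by rewrite divff// pnatr_eq0.
    by rewrite -mulr2n -scaler_nat {1}YE scalerA half scale1r.
  move=> /eqP; rewrite -subr_eq => /eqP YY.
  have -> : x - Y x - (Y x - Y (Y x)) = x - B x.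
    by rewrite -YY !opprD !opprK !addrA.
  rewrite /B opprB addrC subrK scalerA -rmorphM /= divff ?scale1r//.
  by rewrite gt_eqF.
exists S; split; last by apply/funext.
split; last first.
  move=> x; rewrite /S dotZl dotBl mulr_ge0//.
    by rewrite ler0c sqrtr_ge0.
  have real : dot (Y x) x = (complex.Re (dot (Y x) x))%:C.
    rewrite RRe_real//; apply/CrealP.
    exact: (etrans (esym (dotC dot x (Y x))) (esym (Ys x x))).
  rewrite real (dot_self Hnorm) subr_ge0 lecR.
  apply: le_trans (Re_dot_le Hnorm _ _) _.
  by rewrite expr2 ler_wpM2r ?nrm_ge0// -[leRHS]mul1r Y1.2.
apply/bounded_operatorP; exists (c * 2); first by rewrite mulr_gt0 ?sqrtr_gt0.
split=> [a x y|x].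
  rewrite /S Y1.1 scalerA mulrC -scalerA -scalerDr; congr (_ *: _).
  by rewrite scalerBr opprD addrACA.
rewrite /S nrmZ nrm_real ger0_norm ?sqrtr_ge0// -mulrA ler_wpM2l ?sqrtr_ge0//.
apply: le_trans (nrmD _ _) _; rewrite nrmN.
by have := Y1.2 x; lra.
Qed.
End SquareRoot.

(** * Polar decomposition and the trace norm *)

Section TraceClass.
Variables (R : realType) (H : completeNormedModType R[i]).
Variable dot : {dot H for (@Num.conj R[i])}.
Hypothesis Hnorm : hilbert_norm dot.
Hypothesis Hsep : separable_space H.
Local Notation e := (onb dot).

Lemma onb_system : orthonormal_system dot e.
Proof. exact: orthonormal_basis_system (onbP Hnorm Hsep). Qed.

Lemma onb_span x : closed_span dot e x.
Proof. exact: (orthonormal_basis_span x (onbP Hnorm Hsep)). Qed.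

Lemma adjointP (T : H -> H) : bounded_operator T ->
  bounded_operator (adjoint dot T) /\ is_adjoint dot T (adjoint dot T).
Proof.
move=> /(adjoint_exists Hnorm (onbP Hnorm Hsep)) adjT.
exact: (@xgetPex _ _ [set S | bounded_operator S /\ is_adjoint dot T S]).
Qed.

Lemma abs_operatorP (T : H -> H) : bounded_operator T ->
  positive_operator dot (abs_operator dot T) /\
  abs_operator dot T \o abs_operator dot T = adjoint dot T \o T.
Proof.
move=> bT; have [bT' TT'] := adjointP bT.
apply: (@xgetPex _ _ [set P | positive_operator dot P /\ P \o P = adjoint dot T \o T]).
apply: (positive_sqrt_exists Hnorm); split; last first.
  by move=> x /=; rewrite (is_adjoint_sym TT') (dot_self Hnorm) ler0c sqr_ge0.
move: bT bT' => /bounded_operatorP[M M0 TM] /bounded_operatorP[N N0 TN].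
apply/bounded_operatorP; exists (N * M); first exact: mulr_gt0.
by apply: op_bound_comp => //; exact: ltW.
Qed.

(** [|T x|] and [|P x|] agree for [P = abs_operator dot T], so that [P x |-> T x]
   is an isometry on the range of [P]; it has to be extended by 0 to the
   orthogonal complement. Gram-Schmidt on the [P (e k)] provides orthonormal
   vectors [g k = P (u k)] spanning the range, and the [T (u k)] are again
   orthonormal: [V] sends [g k] to [T (u k)]. As [V] preserves the norms of the
   vectors of the range, [V^* V] fixes these vectors. *)
Lemma polar_decomposition (T : H -> H) : bounded_operator T ->
  exists V : H -> H, [/\ op_bound 1 V, V \o abs_operator dot T = T &
    forall x, adjoint dot V (V (abs_operator dot T x)) = abs_operator dot T x].
Proof.
move=> bT; have [pP PP] := abs_operatorP bT.
move: pP PP; set P := abs_operator dot T => pP PP.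
have sP := positive_self_adjoint pP.
have bP := pP.1; have linP := bP.1; have linT := bT.1.
have [_ TT'] := adjointP bT.
have dotTP x y : dot (T x) (T y) = dot (P x) (P y).
  by rewrite TT' sP -[P (P y)]/((P \o P) y) PP.
have nrmTP x : nrm (T x) = nrm (P x).
  apply: (@pexpIrn _ 2) => //; rewrite ?nnegrE ?nrm_ge0//.
  by rewrite !(nrm_sqE Hnorm) dotTP.
pose g := gram_schmidt dot (P \o e).
have og : orthonormal_system dot g := gram_schmidt_orthonormal Hnorm _.
have /choice[u Pu] : forall k, exists x, P x = g k.
  move=> k; have [|x _] := @gram_schmidt_range _ _ dot P (P \o e) linP _ k.
    by move=> n; exists (e n).
  by move=> Px; exists x; exact: Px.
have of_ : orthonormal_system dot (T \o u).
  split=> [k|i j ij] /=; last by rewrite dotTP !Pu og.2.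
  have := og.1 k; rewrite -Pu nrmE => -[/(congr1 (@nrm _ _))|<-]; last first.
    by right; rewrite nrmE nrmTP.
  by rewrite nrm0 -nrmTP => /nrm_eq0; left.
have xK x n : \sum_(0 <= k < n) nrm (dot x (g k) *: (T \o u) k) ^+ 2 <= nrm x ^+ 2.
  apply: le_trans (bessel Hnorm og x n); apply: ler_sum => k _.
  by rewrite /= nrmZ nrmTP Pu -nrmZ nrm_fourier.
pose V x := limn (series (fun k => dot x (g k) *: (T \o u) k)).
have cV x : series (fun k => dot x (g k) *: (T \o u) k) @ \oo --> V x.
  by have [] := riesz_fischer Hnorm of_ (xK x).
have V1 : op_bound 1 V.
  split=> [a x y|x]; last first.
    rewrite mul1r -ler_sqr ?nnegrE ?nrm_ge0//.
    by have [] := riesz_fischer Hnorm of_ (xK x).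
  apply: cvg_lim => //.
  rewrite (_ : series _ = fun n => a *: series (fun k => dot x (g k) *: (T \o u) k) n
     + series (fun k => dot y (g k) *: (T \o u) k) n); last first.
    apply/funext => n; rewrite /series /= scaler_sumr -big_split; apply: eq_bigr => k _.
    by rewrite dotDl dotZl scalerDl scalerA.
  by apply: cvgD; [apply: cvgZr; exact: cV | exact: cV].
have VP x : V (P x) = T x.
  have Pxg : series (fun k => dot (P x) (g k) *: g k) @ \oo --> P x.
    apply: (fourier_cvg Hnorm og) => z zg.
    have zPe := gram_schmidt_perp zg.
    by rewrite -sP; apply: onb_span => k; rewrite sP; exact: zPe.
  (* [T] and [P] have the same norms, so the Fourier expansion of [P x] in the
     [g k = P (u k)] carries over to [T x] and the [T (u k)] *)
  have l2 : series (fun k => dot (P x) (g k) *: (T \o u) k) @ \oo --> T x.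
    have /cvg_nrm h := Pxg; apply: (cvg_nrm_le _ h); apply: nearW => n.
    rewrite /series /=.
    have -> : \sum_(0 <= k < n) dot (P x) (g k) *: T (u k) =
              T (\sum_(0 <= k < n) dot (P x) (g k) *: u k).
      by rewrite (linear_f_sum linT); apply: eq_bigr => k _; rewrite (linear_fZ linT).
    rewrite -(linear_fB linT) nrmTP (linear_fB linP) (linear_f_sum linP).
    have -> // : \sum_(0 <= k < n) P (dot (P x) (g k) *: u k) =
                 \sum_(0 <= k < n) dot (P x) (g k) *: g k.
    by apply: eq_bigr => k _; rewrite (linear_fZ linP) Pu.
  exact: (@cvg_unique _ _ _ _ _ _ (cV (P x)) l2).
have bV : bounded_operator V by apply/bounded_operatorP; exists 1.
have [_ VV'] := adjointP bV.
have V'1 : op_bound 1 (adjoint dot V) by exact: is_adjoint_op_bound VV' V1.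
exists V; split=> //; first by apply/funext.
(* expanding [|V^* V z - z|^2] for [z = P x] leaves [|V^* V z|^2 - |z|^2 <= 0] *)
move=> x; apply/eqP; rewrite -subr_eq0; apply/eqP/nrm_eq0/eqP.
rewrite -sqrf_eq0 eq_le sqr_ge0 andbT (nrmB_sq Hnorm).
rewrite (is_adjoint_sym VV') VP (dot_self Hnorm) nrmTP /=.
have : nrm (adjoint dot V (T x)) ^+ 2 <= nrm (P x) ^+ 2.
  by rewrite ler_sqr ?nnegrE ?nrm_ge0// -nrmTP -[leRHS]mul1r V'1.2.
lra.
Qed.

(** The square of the Hilbert-Schmidt norm. *)
Definition hs_norm_sq (S : H -> H) : \bar R :=
  (\sum_(0 <= k <oo) (nrm (S (e k)) ^+ 2)%:E)%E.

(** Both sides are the sum of the squared moduli of all matrix entries, taken by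
   rows and by columns. *)
Lemma hs_norm_sq_adjoint (S S' : H -> H) :
  is_adjoint dot S S' -> hs_norm_sq S = hs_norm_sq S'.
Proof.
move=> SS'; rewrite /hs_norm_sq.
under eq_eseriesr do rewrite -(parseval Hnorm onb_system (onb_span _)).
rewrite nneseries_interchange; last by move=> *; rewrite lee_fin sqr_ge0.
apply: eq_eseriesr => k _.
rewrite -(parseval Hnorm onb_system (onb_span _)).
by apply: eq_eseriesr => j _; rewrite SS' dotC nrm_conj.
Qed.

Lemma hs_norm_sq_comp (M : R) (D S : H -> H) : 0 <= M -> op_bound M D ->
  (hs_norm_sq (D \o S) <= (M ^+ 2)%:E * hs_norm_sq S)%E.
Proof.
move=> M0 [_ DM]; rewrite /hs_norm_sq -nneseriesZl; last first.
  by move=> k _; rewrite lee_fin sqr_ge0.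
apply: lee_nneseries => k _; first by rewrite lee_fin sqr_ge0.
rewrite -EFinM lee_fin -exprMn ler_sqr ?nnegrE ?nrm_ge0 ?mulr_ge0 ?nrm_ge0//.
exact: DM.
Qed.

Lemma trace_norm_hs (T : H -> H) : bounded_operator T ->
  exists S, [/\ positive_operator dot S, S \o S = abs_operator dot T &
    trace_norm dot T = hs_norm_sq S].
Proof.
move=> bT; have [pP _] := abs_operatorP bT.
have [S [pS SS]] := positive_sqrt_exists Hnorm pP.
exists S; split=> //; apply: eq_eseriesr => k _.
by rewrite -SS /= (positive_self_adjoint pS) (nrm_sqE Hnorm).
Qed.

(** The weights balance the two Hilbert-Schmidt sums of [trace_norm_bound], whose
   bounds are [b ^+ 2] and [d ^+ 2] times the trace norm. *)
Lemma amgm_weighted (b d p q : R) : 0 < b -> 0 < d ->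
  p * q <= d / (2 * b) * p ^+ 2 + b / (2 * d) * q ^+ 2.
Proof.
move=> b0 d0; rewrite -subr_ge0.
have -> : d / (2 * b) * p ^+ 2 + b / (2 * d) * q ^+ 2 - p * q =
   (d * p - b * q) ^+ 2 / (2 * b * d) by field; rewrite !gt_eqF.
by rewrite divr_ge0 ?sqr_ge0// ?mulr_ge0// ltW.
Qed.

(** [D T B = D V S S B], so that each term is the inner product of [S B e_k] and
   [S V^* D^* e_k]; the two families are square summable because their
   Hilbert-Schmidt sums are those of the adjoints [B^* S] and [D V S]. *)
Lemma trace_norm_bound (D T B : H -> H) (d b : R) : 0 < d -> 0 < b ->
  op_bound d D -> bounded_operator T -> op_bound b B ->
  (\sum_(0 <= k <oo) (nrm (dot (D (T (B (e k)))) (e k)))%:E <=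
   (d * b)%:E * trace_norm dot T)%E.
Proof.
move=> d0 b0 Dd bT Bb.
have [V [V1 VP _]] := polar_decomposition bT.
have [S [pS SS ->]] := trace_norm_hs bT.
have sS := positive_self_adjoint pS.
have bdd (M : R) (X : H -> H) : 0 < M -> op_bound M X -> bounded_operator X.
  by move=> M0 XM; apply/bounded_operatorP; exists M.
have [_ VV'] := adjointP (bdd _ _ (@ltr01 R) V1).
have [_ DD'] := adjointP (bdd _ _ d0 Dd).
have [_ BB'] := adjointP (bdd _ _ b0 Bb).
set V' := adjoint dot V in VV'; set D' := adjoint dot D in DD'.
set B' := adjoint dot B in BB'.
have B'b : op_bound b B' := is_adjoint_op_bound Hnorm BB' Bb.
have DV : op_bound d (D \o V) by rewrite -[d]mulr1; apply: op_bound_comp => //; exact: ltW.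
pose p k := nrm (S (B (e k))); pose q k := nrm (S (V' (D' (e k)))).
have dE k : dot (D (T (B (e k)))) (e k) = dot (S (B (e k))) (S (V' (D' (e k)))).
  by rewrite -VP -SS /= DD' VV' sS.
have hp : hs_norm_sq (S \o B) = hs_norm_sq (B' \o S).
  by apply: hs_norm_sq_adjoint; exact: is_adjoint_comp.
have hq : hs_norm_sq (S \o (V' \o D')) = hs_norm_sq ((D \o V) \o S).
  apply: hs_norm_sq_adjoint; apply: is_adjoint_comp => //.
  by apply: is_adjoint_comp; exact: is_adjoint_sym.
have c1 : 0 <= d / (2 * b) by rewrite divr_ge0 ?mulr_ge0 ?(ltW d0) ?(ltW b0).
have c2 : 0 <= b / (2 * d) by rewrite divr_ge0 ?mulr_ge0 ?(ltW d0) ?(ltW b0).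
apply: (@le_trans _ _ ((d / (2 * b))%:E * hs_norm_sq (S \o B) +
                       (b / (2 * d))%:E * hs_norm_sq (S \o (V' \o D')))%E).
  rewrite /hs_norm_sq -!nneseriesZl; try by move=> k _; rewrite lee_fin sqr_ge0.
  rewrite -nneseriesD; try by move=> k _ _; rewrite -EFinM lee_fin mulr_ge0 ?sqr_ge0.
  apply: lee_nneseries => k _; first by rewrite lee_fin nrm_ge0.
  rewrite -!EFinM -EFinD lee_fin dE.
  apply: le_trans (cauchy_schwarz Hnorm _ _) _; exact: amgm_weighted.
rewrite hp hq.
apply: (@le_trans _ _ ((d / (2 * b))%:E * ((b ^+ 2)%:E * hs_norm_sq S) +
                       (b / (2 * d))%:E * ((d ^+ 2)%:E * hs_norm_sq S))%E).
  by apply: leeD; apply: lee_wpmul2l; rewrite ?lee_fin//;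
    apply: hs_norm_sq_comp => //; exact: ltW.
rewrite !muleA -!EFinM -ge0_muleDl ?lee_fin ?(mulr_ge0 c1) ?(mulr_ge0 c2) ?sqr_ge0// -EFinD.
rewrite le_eqVlt; apply/orP; left; apply/eqP; congr (_%:E * _)%E.
by field; rewrite !gt_eqF.
Qed.

(** If [D T B = V |D T B|], then [|D T B| = V^* D T B], whose diagonal entries are
   controlled by [trace_norm_bound]. *)
Lemma trace_class_ideal (D T B : H -> H) : trace_class dot T ->
  bounded_operator D -> bounded_operator B -> trace_class dot (D \o T \o B).
Proof.
move=> [bT tT] /bounded_operatorP[d d0 Dd] /bounded_operatorP[b b0 Bb].
have [t t0 Tt] := (bounded_operatorP T).1 bT.
have bX : bounded_operator (D \o T \o B).
  apply/bounded_operatorP; exists (d * t * b); first by rewrite !mulr_gt0.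
  apply: op_bound_comp => //; first by rewrite mulr_ge0// ltW.
  by apply: op_bound_comp => //; exact: ltW.
split=> //.
have [V [V1 VP VVP]] := polar_decomposition bX.
have bV : bounded_operator V by apply/bounded_operatorP; exists 1.
have [_ VV'] := adjointP bV.
have V'D : op_bound d (adjoint dot V \o D).
  rewrite -[d]mul1r; apply: op_bound_comp => //.
  exact: (is_adjoint_op_bound Hnorm VV' V1).
apply: (@le_lt_trans _ _ ((d * b)%:E * trace_norm dot T)%E); last first.
  by rewrite lte_mul_pinfty// ?lee_fin ?mulr_ge0// ltW.
apply: le_trans (trace_norm_bound d0 b0 V'D bT Bb).
have [[_ pos] _] := abs_operatorP bX.
apply: lee_nneseries => k _.
  by rewrite lee_fin; have := pos (e k); rewrite lecE => /andP[].
rewrite lee_fin -VVP /= -[V _]/((V \o abs_operator dot (D \o T \o B)) _) VP.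
exact: le_trans (ler_norm _) (normRe _).
Qed.

(** Any positive [P] with [P^2 = 0] vanishes, as [|P x|^2 = <P^2 x, x>]. *)
Lemma trace_norm0 : trace_norm dot (0 : H -> H) = 0%E.
Proof.
have b0 : bounded_operator (0 : H -> H).
  by split=> [a x y|]; [rewrite /= scaler0 addr0 | exists 0 => x; rewrite normr0 mul0r].
have [S [pS SS ->]] := trace_norm_hs b0.
have [pP PP] := abs_operatorP b0.
apply: eseries0 => k _ _.
have P0 x : abs_operator dot (0 : H -> H) x = 0.
  apply: nrm_eq0; apply/eqP; rewrite -sqrf_eq0 (nrm_sqE Hnorm).
  rewrite (positive_self_adjoint pP) -[abs_operator _ _ (abs_operator _ _ x)]/((_ \o _) x) PP /=.
  by rewrite (linear_f0 (adjointP b0).1.1) dot0r.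
by rewrite (nrm_sqE Hnorm) (positive_self_adjoint pS) -[S (S _)]/((S \o S) _) SS P0 dot0r.
Qed.

(** The case [D = 1] of [trace_norm_bound]. *)
Lemma trace_comp_cvg (M : R) (T A : H -> H) : 0 < M ->
  op_bound M A -> trace_class dot T ->
  cvgn (series (fun k => dot ((T \o A) (e k)) (e k) : (R[i])^o)) /\
  ((nrm (trace dot (T \o A)))%:E <= M%:E * trace_norm dot T)%E.
Proof.
move=> M0 AM [bT tT].
have id1 : op_bound 1 (@id H) by split=> // x; rewrite mul1r.
have := trace_norm_bound ltr01 M0 id1 bT AM; rewrite mul1r.
set X := (M%:E * _)%E => le_X.
have X0 : (0 <= X)%E.
  by apply: le_trans le_X; apply: nneseries_ge0 => k _ _; rewrite lee_fin nrm_ge0.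
have Xfin : X \is a fin_num.
  by rewrite ge0_fin_numE// lte_mul_pinfty// lee_fin ltW.
rewrite -(fineK Xfin) lee_fin.
apply: (@abs_series_cvg _ (fun k => dot ((T \o A) (e k)) (e k))) => n.
rewrite -lee_fin fineK// -sumEFin; apply: le_trans le_X.
by apply: nneseries_lim_ge => k _ _; rewrite lee_fin nrm_ge0.
Qed.

(** Convergence of both series matters: otherwise the limits would be
   arbitrary. *)
Lemma trace_compB (T S A : H -> H) : bounded_operator A ->
  trace_class dot T -> trace_class dot S ->
  trace dot ((T - S) \o A) = trace dot (T \o A) - trace dot (S \o A).
Proof.
move=> /bounded_operatorP[M M0 AM] tT tS.
have [cT _] := trace_comp_cvg M0 AM tT; have [cS _] := trace_comp_cvg M0 AM tS.
have E : series (fun k => dot (((T - S) \o A) (e k)) (e k) : (R[i])^o) =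
    series (fun k => dot ((T \o A) (e k)) (e k) : (R[i])^o) -
    series (fun k => dot ((S \o A) (e k)) (e k) : (R[i])^o).
  apply/funext => n; rewrite /series /= -[RHS]sumrB; apply: eq_bigr => k _.
  by rewrite -dotBl.
by rewrite /trace E; apply: (cvg_lim (@norm_hausdorff _ _)); exact: cvgB cT cS.
Qed.

Lemma unitary_bounded (U : H -> H) : unitary dot U ->
  bounded_operator U /\ bounded_operator (adjoint dot U).
Proof. by case=> bU _ _; split=> //; exact: (adjointP bU).1. Qed.

Lemma unitary_orbit_trace_class (C Y : H -> H) : trace_class dot C ->
  unitary_orbit dot C Y -> trace_class dot Y.
Proof. by move=> tC [U /unitary_bounded[bU bU'] <-]; exact: trace_class_ideal. Qed.

Lemma unitary_orbit_sub_closed_orbit (C : H -> H) : trace_class dot C ->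
  unitary_orbit dot C `<=` closed_orbit dot C.
Proof.
move=> tC X oX; split; first exact: unitary_orbit_trace_class oX.
by move=> eps eps0; exists X => //; rewrite subrr trace_norm0 lte_fin.
Qed.

End TraceClass.

(** * Density of the numerical range *)

Theorem theorem3p4 (R : realType) (H : completeNormedModType R[i])
    (dot : {dot H for (@Num.conj R[i])})
    (Hnorm : hilbert_norm dot) (Hsep : separable_space H)
    (C A : H -> H) (HC : trace_class dot C) (HA : bounded_operator A) :
  dense_in (numerical_range dot C A) (closed_orbit_numerical_range dot C A)
  /\ closure (numerical_range dot C A)
     = closure (closed_orbit_numerical_range dot C A).
Proof.
have dense : dense_in (numerical_range dot C A) (closed_orbit_numerical_range dot C A).
  split=> [_ [X oX <-]|_ [X [tX appX] <-]].
    by exists X => //; exact: unitary_orbit_sub_closed_orbit.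
  move=> N /nbhs_ballP[r /= r0 rN].
  have rE : r = (complex.Re r)%:C by rewrite RRe_real// gtr0_real.
  have r0' : 0 < complex.Re r by rewrite -ltcR -rE.
  have [M M0 AM] := (bounded_operatorP A).1 HA.
  have [Y oY XY] := appX (complex.Re r / M) (divr_gt0 r0' M0).
  have tY := unitary_orbit_trace_class Hnorm Hsep HC oY.
  exists (trace dot (Y \o A)); split; first by exists Y.
  apply: rN; rewrite -ball_normE /= rE nrmE ltcR.
  rewrite -(trace_compB Hnorm Hsep HA tX tY).
  have tXY : trace_class dot (X - Y).
    split; last exact: lt_trans XY (ltry _).
    move: tX.1 tY.1 => /bounded_operatorP[a a0 [linX Xa]] /bounded_operatorP[b b0 [linY Yb]].
    apply/bounded_operatorP; exists (a + b); first exact: addr_gt0.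
    split=> [c x y|x].
      by rewrite !fctE linX linY scalerBr opprD addrACA.
    by apply: le_trans (nrmD _ _) _; rewrite nrmN mulrDl lerD.
  have [_ le_tr] := trace_comp_cvg Hnorm Hsep M0 AM tXY.
  rewrite -lte_fin; apply: le_lt_trans le_tr _.
  have -> : complex.Re r = M * (complex.Re r / M) by field; rewrite gt_eqF.
  by rewrite EFinM lte_pmul2l.
split=> //; apply/seteqP; split; first exact: closure_subset dense.1.
by move=> z /(closure_subset dense.2); rewrite -((closure_id _).1 (@closed_closure _ _)).
Qed.
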